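(* Let $(U,\|\cdot\|_U)$, $(Z,\|\cdot\|_Z)$ be Banach spaces and let $(\Xi,\mathcal A,\mathbb P)$ be a probability space where $\Xi$ is a separable Banach space $(\Xi,\|\cdot\|_\Xi)$. Let $f_0: Z\to\overline{\mathbb R}$, $s:\Xi\times Z\to U$, $g:U\to\overline{\mathbb R}$ satisfy Assumptions (FG) and (S') of the context. Fix $1\le q\le\infty$ and let $T=L^q(\Xi;\Xi)$. Let $(\theta_\epsilon)_{\epsilon>0}\subset(0,\infty)$ with $\theta_\epsilon\to\infty$ as $\epsilon\downarrow0$. Suppose that the identity map $I(\xi)=\xi$ belongs to $T$, and let $(\eta_\epsilon)_{\epsilon>0}\subset T$. If $q\in[1,\infty)$, assume $$\lim_{\epsilon\downarrow0}\theta_\epsilon\|\eta_\epsilon-I\|_T^q=0,$$ and if $q=\infty$, assume $$\lim_{\epsilon\downarrow0}\theta_\epsilon\|\eta_\epsilon-I\|_T=0.$$ Define $\Phi,\Phi_\epsilon:Z\times T\to\overline{\mathbb R}$ by $$\Phi(z,t)=\begin{cases} f_0(z)+\mathbb E\big[g(s(\xi+t(\xi),z))\big],& t(\xi)=0\ \text{a.s.},\\ \infty,&\text{else,}\end{cases}$$ $$\Phi_\epsilon(z,t)=f_0(z)+\mathbb E\big[g(s(\eta_\epsilon(\xi)+t(\xi),z))\big]+\frac{\theta_\epsilon}{q}\|t\|_T^q,$$ where for $q=\infty$ the term $\frac1q\|t\|_T^q$ is replaced by $\|t\|_T$. Then $\Phi_\epsilon$ $\Gamma_s$-converges to $\Phi$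 on $Z\times T$ as $\epsilon\downarrow0$.
   Context: $\overline{\mathbb R}=\mathbb R\cup\{-\infty,\infty\}$. Arrows $\to$ and $\rightharpoonup$ denote strong (norm) and weak convergence. ''Sequences'' are families indexed by $\epsilon>0$, with limits as $\epsilon\downarrow0$. $\mathbb E[h(\xi)]=\int_\Xi h(\xi)\,d\mathbb P(\xi)$, and ''a.s.'' is with respect to $\mathbb P$. For $q\in[1,\infty)$, $L^q(\Xi;\Xi)$ is the Bochner space of (classes of) strongly measurable maps $\phi:\Xi\to\Xi$ with $\mathbb E[\|\phi(\xi)\|_\Xi^q]<\infty$, with norm $\|\phi\|_T=(\mathbb E[\|\phi(\xi)\|_\Xi^q])^{1/q}$; for $q=\infty$, $L^\infty(\Xi;\Xi)$ is the space of essentially bounded strongly measurable maps with the essential supremum norm. Assumption (S'): (1) $s(\cdot,z):\Xi\to U$ is $\mathcal A$-measurable for all $z\in Z$. (2) If both $\xi_\epsilon\to\xi$ in $\Xi$ and $z_\epsilon\rightharpoonup z$ in $Z$ as $\epsilon\downarrow0$, then $s(\xi_\epsilon,z_\epsilon)\rightharpoonup s(\xi,z)$ in $U$. Assumption (FG): (1) $f_0$ is proper: $f_0(z)>-\infty$ for all $z\in Z$ and $f_0(z)<\infty$ for some $z\in Z$. (2) $f_0$ and $g$ are weakly sequentially lower semicontinuous: $z_\epsilon\rightharpoonup z$ in $Z$ implies $\liminf_{\epsilon\downarrow0}f_0(z_\epsilon)\ge f_0(z)$, and $u_\epsilon\rightharpoonup u$ in $U$ implies $\liminf_{\epsilon\downarrow0}g(u_\epsilon)\ge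 g(u)$. (3) There exists $\gamma\in\mathbb R$ such that $g(u)\ge\gamma$ for all $u\in U$. $\Gamma_s$-convergence: for a Banach space $X$ and maps $h,h_\epsilon:X\to\overline{\mathbb R}$ ($\epsilon>0$), $h_\epsilon$ $\Gamma_s$-converges to $h$ as $\epsilon\downarrow0$ if (i) for every $x\in X$ there exists $(x_\epsilon)_{\epsilon>0}$ with $x_\epsilon\to x$ and $\limsup_{\epsilon\downarrow0}h_\epsilon(x_\epsilon)\le h(x)$; and (ii) for all $(x_\epsilon)_{\epsilon>0}$ with $x_\epsilon\to x$ (strongly), $\liminf_{\epsilon\downarrow0}h_\epsilon(x_\epsilon)\ge h(x)$. Here $X=Z\times T$ with the product norm topology. *)

(* Defs.v *)
From HB Require Import structures.
From mathcomp Require Import all_boot all_order all_algebra.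
From mathcomp Require Import all_classical all_reals all_analysis.
From mathcomp Require Import measurable_realfun ess_sup_inf.

Set Implicit Arguments.
Unset Strict Implicit.
Unset Printing Implicit Defensive.

Import Order.TTheory GRing.Theory Num.Theory.
Import numFieldNormedType.Exports.

Local Open Scope classical_set_scope.
Local Open Scope ring_scope.
Local Open Scope quotient_scope.

(* A Banach space carrying a sigma-algebra; no compatibility with the topology
   is imposed. *)
#[short(type="measurableBanachType")]
HB.structure Definition MeasurableBanach (d : measure_display)
    (R : numFieldType) :=
  {X of Measurable d X & CompleteNormedModule R X}.

Definition separable (X : topologicalType) :=
  exists2 D : set X, countable D & dense D.

Section strongly_measurable.
Context (d : measure_display) (T : measurableType d) (R : realType)
  (V : normedModType R).
Implicit Types f g : T -> V.

Definition simple_map f :=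
  finite_set (range f) /\ forall v, measurable (f @^-1` [set v]).

(* Everywhere limits of simple maps: every a.e. limit of simple maps has such a
   representative, so the spaces of classes below are the usual ones. *)
Definition strongly_measurable f :=
  exists2 f_ : nat -> T -> V, (forall n, simple_map (f_ n)) &
    forall x, f_ n x @[n --> \oo] --> f x.

Lemma simple_map0 : simple_map (0 : T -> V).
Proof.
split; first by apply: (sub_finite_set _ (finite_set1 (0 : V))) => _ [x _ <-].
move=> v; have [->|v0] := eqVneq v 0.
  rewrite (_ : _ @^-1` _ = setT); first exact: measurableT.
  by apply/seteqP; split => x.
rewrite (_ : _ @^-1` _ = set0); first exact: measurable0.
by apply/seteqP; split => x //= vE; move: v0; rewrite -vE eqxx.
Qed.

Lemma simple_map_lin a f g : simple_map f -> simple_map g ->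
  simple_map (a *: f + g).
Proof.
move=> [ff mf] [fg mg]; split.
  apply: (sub_finite_set _
    (finite_image2 (fun u v => a *: u + v) ff fg)) => _ [x _ <-].
  by exists (f x); [exists x|exists (g x); [exists x|]].
move=> v; rewrite (_ : _ @^-1` _ =
    \bigcup_(u in range f) (f @^-1` [set u] `&` g @^-1` [set v - a *: u])).
  by apply: fin_bigcup_measurable => // u _; exact: measurableI.
apply/seteqP; split => [x /= <-|x [u _] [/= <- gv]].
  by exists (f x); [exists x|split => //=; rewrite addrAC subrr add0r].
by transitivity (a *: f x + g x) => //; rewrite gv addrC subrK.
Qed.

Lemma strongly_measurable0 : strongly_measurable (0 : T -> V).
Proof.
exists (fun=> 0) => [_|x]; first exact: simple_map0.
exact: cvg_cst.
Qed.

Lemma strongly_measurable_lin a f g :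
  strongly_measurable f -> strongly_measurable g ->
  strongly_measurable (a *: f + g).
Proof.
move=> [f_ sf cf] [g_ sg cg]; exists (fun n => a *: f_ n + g_ n) => [n|x].
  exact: simple_map_lin.
by apply: cvgD; [apply: cvgZr|].
Qed.

Lemma measurable_norm_simple_map f : simple_map f ->
  measurable_fun [set: T] (fun x => `|f x|).
Proof.
move=> [ff mf] _ B mB; rewrite setTI.
rewrite (_ : _ @^-1` B =
    \bigcup_(u in range f `&` [set u | B `|u|]) (f @^-1` [set u])).
  by apply: fin_bigcup_measurable => //; exact: finite_setIl.
apply/seteqP; split => [x /= Bx|x [u [_ /= Bu] /= ->]//].
by exists (f x) => //; split => //; exists x.
Qed.

Lemma measurable_norm_strongly_measurable f : strongly_measurable f ->
  measurable_fun [set: T] (fun x => `|f x|).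
Proof.
move=> [f_ sf cf].
apply: (@measurable_fun_cvg _ _ _ _ (fun n x => `|f_ n x|)) => [n|x _].
  exact: measurable_norm_simple_map.
by apply: cvg_norm; exact: cf.
Qed.

End strongly_measurable.

Section ae_le_Lnorm.
Context (d : measure_display) (T : measurableType d) (R : realType).
Variable mu : {measure set T -> \bar R}.
Local Open Scope ereal_scope.

Lemma ae_le_Lnorm (q : \bar R) (f g : T -> R) : 1 <= q ->
  measurable_fun [set: T] f -> measurable_fun [set: T] g ->
  (\forall x \ae mu, `|f x| <= `|g x|)%R ->
  'N[mu]_q[EFin \o f] <= 'N[mu]_q[EFin \o g].
Proof.
move=> + mf mg fg; rewrite unlock /Lnorm; case: q => [r r1| _|//].
- have r0 : (0 <= r)%R by rewrite (le_trans ler01).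
  have mp (h : T -> R) : measurable_fun [set: T] h ->
      measurable_fun [set: T] (fun x => `|(EFin \o h) x| `^ r).
    move=> mh; apply/measurable_EFinP.
    by apply: (@measurableT_comp _ _ _ _ _ _ (@powR R ^~ r)) => //;
      exact: measurableT_comp.
  have ge0 (h : T -> R) : 0 <= \int[mu]_x (`|h x| `^ r)%:E.
    by apply: integral_ge0 => x _; rewrite lee_fin powR_ge0.
  apply: gt0_ler_poweR; rewrite ?invr_ge0 ?in_itv/= ?leey ?andbT ?ge0//.
  apply: ae_ge0_le_integral => //; try exact: mp;
    try by move=> x _; rewrite lee_fin powR_ge0.
  by apply: filterS fg => x fgx _; rewrite lee_fin ge0_ler_powR// nnegrE.
- case: ifPn => // _; apply: le_ess_sup.
  by apply: filterS fg => x fgx /=; rewrite lee_fin.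
Qed.

End ae_le_Lnorm.

Section bochner_map.
Context (d : measure_display) (T : measurableType d) (R : realType)
  (mu : {measure set T -> \bar R}) (V : normedModType R) (q : \bar R).

Definition bochner_pred : {pred (T -> V)} :=
  mem [set f : T -> V | strongly_measurable f /\
    finite_norm mu q (fun x => `|f x|)].

(* q1 is a phantom parameter: it lets the vector space structure, which needs
   1 <= q, be inferred. *)
Record bochner_map (q1 : (1 <= q)%E) := BochnerMap {
  bochner_fun :> T -> V ;
  bochner_funP : bochner_fun \in bochner_pred }.

Context (q1 : (1 <= q)%E).
Local Notation bochnerMap := (bochner_map q1).

HB.instance Definition _ := [isSub of bochnerMap for @bochner_fun q1].
HB.instance Definition _ := [Choice of bochnerMap by <:].

Lemma norm_Lfun f : f \in bochner_pred -> (fun x => `|f x|) \in Lfun mu q.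
Proof.
rewrite inE => -[mf ff]; rewrite inE; apply/andP; split; rewrite inE//=.
exact: measurable_norm_strongly_measurable.
Qed.

Lemma measurable_norm f : f \in bochner_pred ->
  measurable_fun [set: T] (fun x => `|f x|).
Proof. by rewrite inE => -[/measurable_norm_strongly_measurable]. Qed.

Lemma bochner_LnormZ a f : f \in bochner_pred ->
  ('N[mu]_q[EFin \o (fun x => `|a *: f x|%R)] =
   `|a|%:E * 'N[mu]_q[EFin \o (fun x => `|f x|%R)])%E.
Proof.
move=> /norm_Lfun Lf; have := LnormZ (Lfun_Sub q1 Lf) `|a|.
rewrite normr_id => <-; apply: eq_Lnorm => x /=.
by rewrite normrZ.
Qed.

Lemma bochner_pred_submod_closed : submod_closed bochner_pred.
Proof.
split.
  rewrite inE; split; first exact: strongly_measurable0.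
  rewrite /finite_norm (_ : _ \o _ = cst 0%E); last first.
    by apply/funext => x /=; rewrite normr0.
  by rewrite Lnorm0// gt_eqF// (lt_le_trans _ q1).
move=> a f g Lf Lg.
have [sf sg] : strongly_measurable f /\ strongly_measurable g.
  by move: Lf Lg; rewrite !inE => -[? _] [].
have sh := strongly_measurable_lin a sf sg.
rewrite inE; split => //; rewrite /finite_norm.
have maf : measurable_fun [set: T] (fun x => `|a *: f x|).
  under eq_fun do rewrite normrZ.
  by apply: measurable_funM => //; exact: measurable_norm.
apply: (@le_lt_trans _ _
    ('N[mu]_q[EFin \o (fun x => `|a *: f x| + `|g x|)%R])%E).
  apply: ae_le_Lnorm => //.
  - exact: measurable_norm_strongly_measurable.
  - by apply: measurable_funD => //; exact: measurable_norm.
  - by apply/nearW => x; rewrite !ger0_norm ?addr_ge0//; exact: ler_normD.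
apply: (le_lt_trans (eminkowski mu maf (measurable_norm Lg) q1)).
rewrite bochner_LnormZ//; move: Lf Lg; rewrite !inE => -[_ ff] [_ fg].
by rewrite lte_add_pinfty// lte_mul_pinfty ?lee_fin.
Qed.

HB.instance Definition _ :=
  GRing.isSubmodClosed.Build _ _ bochner_pred bochner_pred_submod_closed.
HB.instance Definition _ := [SubChoice_isSubLmodule of bochnerMap by <:].

Definition bochner_norm (f : bochnerMap) : R :=
  fine ('N[mu]_q[EFin \o (fun x => `|f x|%R)])%E.

Lemma bochner_normE (f : bochnerMap) :
  (bochner_norm f)%:E = ('N[mu]_q[EFin \o (fun x => `|f x|%R)])%E.
Proof.
rewrite fineK// fin_numElt (lt_le_trans ltNy0) ?Lnorm_ge0//=.
by have := bochner_funP f; rewrite inE => -[].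
Qed.

Lemma bochner_normD (f g : bochnerMap) :
  bochner_norm (f + g) <= bochner_norm f + bochner_norm g.
Proof.
rewrite -lee_fin EFinD !bochner_normE.
have [mf mg] := (measurable_norm (bochner_funP f),
                 measurable_norm (bochner_funP g)).
apply: le_trans (eminkowski mu mf mg q1); apply: ae_le_Lnorm => //.
- exact: (measurable_norm (bochner_funP (f + g))).
- exact: measurable_funD.
- by apply/nearW => x; rewrite !ger0_norm ?addr_ge0//=; exact: ler_normD.
Qed.

Lemma bochner_normZ a (f : bochnerMap) :
  bochner_norm (a *: f) = `|a| * bochner_norm f.
Proof.
apply/EFin_inj; rewrite EFinM !bochner_normE -bochner_LnormZ//.
exact: bochner_funP.
Qed.

Lemma bochner_norm_eq0 (f : bochnerMap) :
  bochner_norm f = 0 -> {ae mu, forall x, f x = 0}.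
Proof.
move=> f0; have := bochner_normE f; rewrite f0 => /esym/Lnorm_eq0_eq0.
have mf : measurable_fun [set: T] (EFin \o (fun x => `|f x|)).
  exact/measurable_EFinP/measurable_norm/bochner_funP.
move=> /(_ mf (lt_le_trans lte01 q1)).
by apply: filterS => x /(_ Logic.I) /= -[] /normr0_eq0.
Qed.

Lemma ae_eq_bochner_norm (f g : bochnerMap) :
  {ae mu, forall x, f x = g x} -> bochner_norm f = bochner_norm g.
Proof.
move=> fg; apply/EFin_inj/eqP; rewrite !bochner_normE eq_le.
have [mf mg] := (measurable_norm (bochner_funP f),
                 measurable_norm (bochner_funP g)).
by apply/andP; split; apply: ae_le_Lnorm => //; apply: filterS fg => x ->.
Qed.

Definition bochner_eq (f g : bochnerMap) := `[< {ae mu, forall x, f x = g x} >].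

Let bochner_eq_refl : reflexive bochner_eq.
Proof. by move=> f; apply/asboolP/nearW. Qed.

Let bochner_eq_sym : symmetric bochner_eq.
Proof.
by move=> f g; apply/idP/idP => /asboolP fg; apply/asboolP;
  apply: filterS fg => x ->.
Qed.

Let bochner_eq_trans : transitive bochner_eq.
Proof.
move=> f g h /asboolP gf /asboolP fh; apply/asboolP.
by apply: filterS2 gf fh => x -> ->.
Qed.

Canonical bochner_eq_canonical :=
  EquivRel bochner_eq bochner_eq_refl bochner_eq_sym bochner_eq_trans.

End bochner_map.

(* The space L^q(T; V) of mu-a.e. classes; a class coerces to the function
   underlying its canonical representative. *)
Definition Bochner (d : measure_display) (T : measurableType d) (R : realType)
    (mu : {measure set T -> \bar R}) (V : normedModType R)
    (q : \bar R) (q1 : (1 <= q)%E) : Type :=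
  {eq_quot (@bochner_eq d T R mu V q q1)}.
Arguments Bochner {d T R} mu V {q} q1.

Section bochner_space.
Context (d : measure_display) (T : measurableType d) (R : realType)
  (mu : {measure set T -> \bar R}) (V : normedModType R)
  (q : \bar R) (q1 : (1 <= q)%E).

Local Notation L := (Bochner mu V q1).
Local Notation M := (@bochner_map d T R mu V q q1).

HB.instance Definition _ := Choice.on L.
HB.instance Definition _ := EqQuotient.on L.

Definition Bochner_fun (f : L) : T -> V := (repr f : M).

Definition Bochner_class (f : M) : L := \pi f.

Lemma Bochner_classP (f g : M) :
  {ae mu, forall x, f x = g x} <-> Bochner_class f = Bochner_class g.
Proof.
split => [fg|/eqmodP/asboolP//].
by apply/eqmodP/asboolP.
Qed.

Lemma Bochner_classW (Q : L -> Prop) :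
  (forall f, Q (Bochner_class f)) -> forall f, Q f.
Proof. by move=> h f; rewrite -[f]reprK; exact: h. Qed.

Lemma Bochner_funE (f : M) :
  {ae mu, forall x, Bochner_fun (Bochner_class f) x = f x}.
Proof. by apply/(@Bochner_classP (repr _)); exact: reprK. Qed.

Definition Bochner_zero : L := Bochner_class 0.
Definition Bochner_opp (f : L) : L := Bochner_class (- repr f).
Definition Bochner_add (f g : L) : L := Bochner_class (repr f + repr g).
Definition Bochner_scale (a : R) (f : L) : L := Bochner_class (a *: repr f).
Definition Bochner_norm (f : L) : R := bochner_norm (repr f).

Lemma Bochner_addE (f g : M) :
  Bochner_add (Bochner_class f) (Bochner_class g) = Bochner_class (f + g).
Proof.
apply/Bochner_classP; apply: filterS2 (Bochner_funE f) (Bochner_funE g).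
by move=> x fx gx; exact: (congr2 +%R fx gx).
Qed.

Lemma Bochner_oppE (f : M) : Bochner_opp (Bochner_class f) = Bochner_class (- f).
Proof.
apply/Bochner_classP; apply: filterS (Bochner_funE f).
by move=> x fx; exact: (congr1 -%R fx).
Qed.

Lemma Bochner_scaleE a (f : M) :
  Bochner_scale a (Bochner_class f) = Bochner_class (a *: f).
Proof.
apply/Bochner_classP; apply: filterS (Bochner_funE f).
by move=> x fx; exact: (congr1 ( *:%R a) fx).
Qed.

Lemma Bochner_normE (f : M) : Bochner_norm (Bochner_class f) = bochner_norm f.
Proof. exact/ae_eq_bochner_norm/Bochner_funE. Qed.

Let addA : associative Bochner_add.
Proof.
move=> f g h; elim/Bochner_classW: f => f; elim/Bochner_classW: g => g.
elim/Bochner_classW: h => h.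
rewrite (Bochner_addE g) (Bochner_addE f) (Bochner_addE f).
by rewrite (Bochner_addE (f + g)) addrA.
Qed.

Let addC : commutative Bochner_add.
Proof.
move=> f g; elim/Bochner_classW: f => f; elim/Bochner_classW: g => g.
by rewrite (Bochner_addE f) (Bochner_addE g) addrC.
Qed.

Let add0 : left_id Bochner_zero Bochner_add.
Proof.
by move=> f; elim/Bochner_classW: f => f; rewrite (Bochner_addE 0) add0r.
Qed.

Let addN : left_inverse Bochner_zero Bochner_opp Bochner_add.
Proof.
move=> f; elim/Bochner_classW: f => f.
by rewrite (Bochner_oppE f) (Bochner_addE (- f)) addNr.
Qed.

HB.instance Definition _ := GRing.isZmodule.Build L addA addC add0 addN.

Let scaleA a b f : Bochner_scale a (Bochner_scale b f) = Bochner_scale (a * b) f.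
Proof.
elim/Bochner_classW: f => f.
by rewrite (Bochner_scaleE b) (Bochner_scaleE a) (Bochner_scaleE (a * b)) scalerA.
Qed.

Let scale1 : left_id 1 Bochner_scale.
Proof.
by move=> f; elim/Bochner_classW: f => f; rewrite (Bochner_scaleE 1) scale1r.
Qed.

Let scaleDr : right_distributive Bochner_scale +%R.
Proof.
move=> a f g; elim/Bochner_classW: f => f; elim/Bochner_classW: g => g.
rewrite [X in Bochner_scale a X](Bochner_addE f) !(Bochner_scaleE a) scalerDr.
exact/esym/Bochner_addE.
Qed.

Let scaleDl f : {morph Bochner_scale^~ f : a b / a + b}.
Proof.
move=> a b; elim/Bochner_classW: f => f.
rewrite (Bochner_scaleE (a + b)) (Bochner_scaleE a) (Bochner_scaleE b) scalerDl.
exact/esym/Bochner_addE.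
Qed.

HB.instance Definition _ :=
  GRing.Zmodule_isLmodule.Build R L scaleA scale1 scaleDr scaleDl.

Let normD (f g : L) : Bochner_norm (f + g) <= Bochner_norm f + Bochner_norm g.
Proof.
elim/Bochner_classW: f => f; elim/Bochner_classW: g => g.
rewrite [X in Bochner_norm X](Bochner_addE f) !Bochner_normE.
exact: bochner_normD.
Qed.

Let normZ (a : R) (f : L) : Bochner_norm (a *: f) = `|a| * Bochner_norm f.
Proof.
elim/Bochner_classW: f => f.
rewrite [X in Bochner_norm X](Bochner_scaleE a) !Bochner_normE.
exact: bochner_normZ.
Qed.

Let norm_eq0 (f : L) : Bochner_norm f = 0 -> f = 0.
Proof.
elim/Bochner_classW: f => f; rewrite Bochner_normE => /bochner_norm_eq0 f0.
exact/Bochner_classP.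
Qed.

HB.instance Definition _ := Lmodule_isNormed.Build R L normD normZ norm_eq0.

End bochner_space.

Coercion Bochner_fun : Bochner >-> Funclass.

Section convergence.
Context (R : realType).

Definition weakly_cvg (X : normedModType R) (x_ : R -> X) (x : X) :=
  forall l : {linear X -> R^o}, continuous l ->
    l (x_ e) @[e --> 0^'+] --> l x.

Definition weakly_seq_lsc (X : normedModType R) (h : X -> \bar R) :=
  forall (x_ : R -> X) (x : X), weakly_cvg x_ x ->
    (h x <= limf_einf (fun e => h (x_ e)) 0^'+)%E.

Definition Gamma_s_cvg (X : normedModType R) (h_ : R -> X -> \bar R)
    (h : X -> \bar R) :=
  (forall x : X, exists2 x_ : R -> X, x_ e @[e --> 0^'+] --> x &
    (limf_esup (fun e => h_ e (x_ e)) 0^'+ <= h x)%E) /\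
  (forall (x_ : R -> X) (x : X), x_ e @[e --> 0^'+] --> x ->
    (h x <= limf_einf (fun e => h_ e (x_ e)) 0^'+)%E).

End convergence.

Section problem.
Context (R : realType) (d : measure_display)
  (U Z : completeNormedModType R) (Xi : measurableBanachType d R).

Definition assumption_S' (s : Xi -> Z -> U) :=
  (forall z, measurable_fun [set: Xi]
    (fun xi => s xi z : g_sigma_algebraType (@open U))) /\
  (forall (xi_ : R -> Xi) (xi : Xi) (z_ : R -> Z) (z : Z),
    xi_ e @[e --> 0^'+] --> xi -> weakly_cvg z_ z ->
    weakly_cvg (fun e => s (xi_ e) (z_ e)) (s xi z)).

Definition assumption_FG (f0 : Z -> \bar R) (g : U -> \bar R) :=
  [/\ (forall z, -oo < f0 z)%E /\ (exists z, f0 z < +oo)%E,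
      weakly_seq_lsc f0 /\ weakly_seq_lsc g &
      exists gamma : R, forall u, (gamma%:E <= g u)%E].

Context (P : probability Xi R) (q : \bar R) (q1 : (1 <= q)%E)
  (f0 : Z -> \bar R) (s : Xi -> Z -> U) (g : U -> \bar R).

(* t and eta e stand for the canonical representatives of their classes; under
   the assumptions above the integrals in Phi and Phi_ do not depend on the
   representatives. *)
Definition Phi (x : Z * Bochner P Xi q1) : \bar R :=
  let: (z, t) := x in
  if `[< {ae P, forall xi, t xi = 0} >]
  then (f0 z + \int[P]_xi g (s (xi + t xi)%R z))%E
  else +oo%E.

(* (1/q) ||t||^q, replaced by ||t|| when q = +oo; q = -oo is excluded by q1. *)
Definition penalty (t : Bochner P Xi q1) : R :=
  if q is r%:E then r^-1 * `|t| `^ r else `|t|.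

Definition Phi_ (theta : R -> R) (eta : R -> Bochner P Xi q1) (e : R)
    (x : Z * Bochner P Xi q1) : \bar R :=
  let: (z, t) := x in
  (f0 z + \int[P]_xi g (s (eta e xi + t xi)%R z) + (theta e * penalty t)%R%:E)%E.

End problem.

(* Main.v *)
(** The function [F (xi, z) = g (s xi z)] is jointly lower semicontinuous in
    norm and bounded below.

    Recovery: if [t = 0] a.s., take the constant family [z] and
    [t_e = I - eta_e], so that [eta_e + t_e = I] a.s. and only the vanishing
    penalty is left.

    Lower bound: if [t <> 0], the penalty blows up. If [t = 0] a.s., then
    [(eta_e + t_e, z_e)] converges in probability to [(I, z)], and Fatou's lemma
    is replaced by an argument without subsequences: the truncated infima [G_k]
    of [F] over balls of radius [1/(k+1)] increase to [F], and, as soon as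
    [|z_e - z| < 1/(k+1)],
    [G_k(I, z) <= F (eta_e + t_e, z_e)] off the event
    [|eta_e + t_e - I| >= 1/(k+1)], whose probability tends to [0]. *)

Require Import Defs.
From HB Require Import structures.
From mathcomp Require Import all_boot all_order all_algebra.
From mathcomp Require Import all_classical all_reals all_analysis.
From mathcomp Require Import measurable_realfun ess_sup_inf lra.

Set Implicit Arguments.
Unset Strict Implicit.
Unset Printing Implicit Defensive.

Import Order.TTheory GRing.Theory Num.Theory.
Import numFieldNormedType.Exports.

Local Open Scope classical_set_scope.
Local Open Scope ring_scope.

(** * Lower limits along a filter and lower semicontinuity *)

Lemma lte_dense_EFin (R : realFieldType) (x y : \bar R) :
  (x < y)%E -> exists c : R, (x < c%:E < y)%E.
Proof.
case: x y => [x| |] [y| |]//.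
- by rewrite lte_fin => xy; exists ((x + y) / 2); rewrite !lte_fin; lra.
- by exists (x + 1); rewrite lte_fin ltrDl ltr01 ltry.
- by exists (y - 1); rewrite lte_fin ltrBlDr ltrDl ltr01 ltNyr.
- by exists 0; rewrite ltNyr ltry.
Qed.

Section limf_einf_near.
Context (R : realType) (T : choiceType) (X : filteredType T).
Implicit Types (f : X -> \bar R) (F : set_system X) (l : \bar R).
Local Open Scope ereal_scope.

(** The lower limit is a supremum over the sets of [F], and the set where [c <= f] is one of them;
    real [c] suffice by density. *)
Lemma le_limf_einf f F l :
  (forall c : R, c%:E < l -> \forall x \near F, c%:E <= f x) ->
  l <= limf_einf f F.
Proof.
move=> fl; rewrite leNgt; apply/negP => /lte_dense_EFin[c /andP[fc cl]].
move: fc; rewrite ltNge => /negP; apply; rewrite limf_einfE.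
apply: le_ereal_sup_tmp; exists (ereal_inf (f @` [set x | c%:E <= f x])).
  by exists [set x | c%:E <= f x] => //; exact: fl.
by apply: le_ereal_inf_tmp => _ [x cfx <-].
Qed.

Lemma limf_esup_le f F l : Filter F ->
  (forall c : R, l < c%:E -> \forall x \near F, f x <= c%:E) ->
  limf_esup f F <= l.
Proof.
move=> FF fl; rewrite -[limf_esup _ _]oppeK -limf_einfN leeNl.
apply: le_limf_einf => c cl; have /fl : l < (- c)%:E by rewrite EFinN lteNr.
by apply: filterS => x; rewrite EFinN leeNr.
Qed.

Lemma limf_einf_le f F l : ProperFilter F ->
  (\forall x \near F, f x <= l) -> limf_einf f F <= l.
Proof.
move=> FF fl; rewrite limf_einfE; apply: ge_ereal_sup => _ [V FV <-].
have [x [Vx fxl]] := filter_ex (filterI FV fl).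
by apply: ge_ereal_inf; exists (f x) => //; exists x.
Qed.

End limf_einf_near.

(** If semicontinuity failed at [x], every ball around [x] would contain a point with
    [h <= a < h x]. Using the radius as index turns these points into a family converging to [x],
    against the hypothesis. *)
Lemma lower_semicontinuous_family (R : realType) (X : normedModType R)
    (h : X -> \bar R) :
  (forall (x_ : R -> X) (x : X), x_ e @[e --> 0^'+] --> x ->
    (h x <= limf_einf (fun e => h (x_ e)) 0^'+)%E) ->
  lower_semicontinuous h.
Proof.
move=> hl x a ahx; apply: contrapT => hV.
have /choice[x_ x_P] (e : R) : exists y, 0 < e -> ball x e y /\ (h y <= a%:E)%E.
  have [e0|e0] := ltP 0 e; last by exists x.
  apply: contrapT => ynP; apply: hV; exists (ball x e).
    exact: nbhsx_ballx.
  by move=> y xy; rewrite ltNge; apply/negP => hy; apply: ynP; exists y.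
suff /hl : x_ e @[e --> 0^'+] --> x.
  move=> /(lt_le_trans ahx); rewrite ltNge => /negP; apply.
  apply: limf_einf_le; near=> e; apply: (x_P e _).2.
  by near: e; exact: nbhs_right_gt.
apply/cvg_ballP => r r0; near=> e.
have e0 : 0 < e by near: e; exact: nbhs_right_gt.
apply: (le_ball _ (x_P e e0).1).
by near: e; exact: nbhs_right_le.
Unshelve. all: by end_near. Qed.

Lemma strongly_weakly_cvg (R : realType) (X : normedModType R) (x_ : R -> X)
    (x : X) : x_ e @[e --> 0^'+] --> x -> weakly_cvg x_ x.
Proof. by move=> xx l cl; apply: continuous_cvg => //; exact: cl. Qed.

(** * Measurability of compositions with strongly measurable maps *)

Section strongly_measurable_comp.
Context (d : measure_display) (T : measurableType d) (R : realType)
  (V : normedModType R).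

(** [f x] lies in [O] exactly when, for some [k], the ball of radius [r k] about [f_ n x] is
    eventually inside [O]. A simple map pulls every set back to a measurable one, so only countable
    operations remain. *)
Lemma strongly_measurable_open (f : T -> V) (O : set V) :
  strongly_measurable f -> open O -> measurable (f @^-1` O).
Proof.
move=> [f_ sf cf] oO.
pose r k : R := k.+1%:R^-1.
pose A k n := f_ n @^-1` [set v | ball v (r k) `<=` O].
have -> : f @^-1` O =
    \bigcup_k \bigcup_N \bigcap_(n in [set n | (N <= n)%N]) A k n.
  apply/seteqP; split => [x Ofx|x [k _ [N _ Ax]]].
    have /nbhs_ballP[e /= e0 fxe] : nbhs (f x) O by exact: open_nbhs_nbhs.
    (* One half of [e] bounds the distance from [f_ n x] to [f x], the other half the radius
       [r k]. *)
    have e20 : 0 < e / 2 by rewrite divr_gt0.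
    have [k] := ltr_add_invr e20; rewrite add0r -/(r k) => kP.
    have /cvg_ballP/(_ _ e20)[N _ NP] := cf x.
    exists k => //; exists N => // n Nn v /(le_ball (ltW kP)) fnv.
    apply: fxe; rewrite [e]splitr; apply: ball_triangle fnv.
    exact: NP.
  have /cvg_ballP/(_ (r k))[|M _ MP] := cf x; first by rewrite invr_gt0.
  apply: (Ax (maxn N M)); first exact: leq_maxl.
  by apply: ball_sym; apply: MP; exact: leq_maxr.
apply: bigcup_measurable => k _; apply: bigcup_measurable => N _.
apply: bigcap_measurable => [|n _]; first by exists N => /=.
have [ff mf] := sf n.
rewrite (_ : A k n =
    \bigcup_(u in range (f_ n) `&` [set v | ball v (r k) `<=` O])
      (f_ n @^-1` [set u])).
  by apply: fin_bigcup_measurable => //; exact: finite_setIl.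
apply/seteqP; split => [x /= Ax|x [u [_ Bu] /= xu]].
  by exists (f_ n x) => //; split => //; exists x.
by rewrite /A/= xu.
Qed.

Lemma lower_semicontinuous_comp_measurable (h : V -> \bar R) (f : T -> V) :
  lower_semicontinuous h -> strongly_measurable f ->
  measurable_fun [set: T] (h \o f).
Proof.
move=> /lower_semicontinuousP hh sf.
apply: (measurability _ (ErealGenOInfty.measurableE R)).
move=> /= _ [_ [a ->]] <-; apply: measurableI => //; rewrite preimage_itvoy.
exact: (strongly_measurable_open sf (hh a)).
Qed.

End strongly_measurable_comp.

(** * Integrals of functions that agree almost everywhere or are bounded below *)

Section eq_integral_ae.
Context (d : measure_display) (T : measurableType d) (R : realType)
  (mu : {measure set T -> \bar R}).
Local Open Scope ereal_scope.
Import HBNNSimple.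

(* The integral of a nonnegative function is a supremum over the simple
   functions below it, which can be set to 0 on a negligible set. This also
   covers nonmeasurable integrands: xi |-> g (s (xi + t xi) z) may be one, since
   the sigma-algebra of Xi need not be related to its topology. *)
Let ge0_le_integral_ae (f g : T -> \bar R) :
  (forall x, 0 <= f x) -> (forall x, 0 <= g x) ->
  {ae mu, forall x, f x = g x} -> \int[mu]_x f x <= \int[mu]_x g x.
Proof.
move=> f0 g0 [A [mA A0 fgA]]; rewrite !ge0_integralTE//.
apply: ge_ereal_sup => _ [h hf <-]; apply: le_ereal_sup_tmp.
exists (sintegral mu (proj_nnsfun h (measurableC mA))).
  exists (proj_nnsfun h (measurableC mA)) => //= x; rewrite mindicE in_setC.
  have [xA|xA] := boolP (x \in A); first by rewrite mulr0.
  rewrite mulr1 (le_trans (hf x))// le_eqVlt; apply/orP; left; apply/eqP.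
  by apply: contrapT => fgx; move: xA; rewrite notin_setE; apply; exact: fgA.
have sE (k : {nnsfun T >-> R}) : sintegral mu k = \int[mu]_x (k x)%:E.
  by rewrite integral_nnsfun// patch_setT.
rewrite !sE le_eqVlt; apply/orP; left; apply/eqP; apply: ae_eq_integral => //.
- exact/measurable_EFinP.
- exact/measurable_EFinP.
exists A; split => // x /= hx; apply: contrapT => xA; apply: hx => _.
by rewrite mindicE in_setC memNset// mulr1.
Qed.

Lemma eq_integral_ae (f g : T -> \bar R) :
  {ae mu, forall x, f x = g x} -> \int[mu]_x f x = \int[mu]_x g x.
Proof.
move=> fg; have gf : {ae mu, forall x, g x = f x} by apply: filterS fg.
rewrite integralE [RHS]integralE; congr (_ - _); apply/eqP; rewrite eq_le;
  apply/andP; split; apply: ge0_le_integral_ae => //;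
  [move: fg|move: gf|move: fg|move: gf]; apply: filterS => x;
  by rewrite ?funeposE ?funenegE => ->.
Qed.

End eq_integral_ae.

(** The integral of [f] may be infinite, so additivity for integrable functions does not apply. The
    negative part is at most [c], hence integrable, and [f + c] is the sum of the nonnegative
    functions [f^\+] and [c - f^\-]. *)
Lemma integralD_cst_lbounded (d : measure_display) (T : measurableType d)
    (R : realType) (P : probability T R) (c : R) (f : T -> \bar R) :
  0 <= c -> measurable_fun [set: T] f -> (forall x, (- c)%:E <= f x)%E ->
  (\int[P]_x (f x + c%:E) = \int[P]_x f x + c%:E)%E.
Proof.
move=> c0 mf fc.
have fnc x : (f^\- x <= c%:E)%E.
  by rewrite funenegE ge_max lee_fin c0 andbT leeNl -EFinN.
have ic : P.-integrable [set: T] (cst c%:E).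
  exact: finite_measure_integrable_cst.
have ifn : P.-integrable [set: T] (f^\-)%E.
  apply: le_integrable ic => //; first exact: measurable_funeneg.
  by move=> x _; rewrite !gee0_abs ?lee_fin.
have intc : (\int[P]_x (cst c%:E x) = c%:E)%E.
  by rewrite integral_cst// [X in (_ * X)%E](@probability_setT _ _ _ P) mule1.
transitivity (\int[P]_x (f^\+ x + (c%:E - f^\- x)))%E.
  apply: eq_integral => x _; rewrite [in LHS](funeposneg f)/=.
  by rewrite -addeA; congr (_ + _)%E; rewrite addeC.
rewrite ge0_integralD//.
- rewrite (@integralB _ _ _ P _ measurableT (cst c%:E))// intc.
  by rewrite [in RHS]integralE -addeA; congr (_ + _)%E; exact: addeC.
- exact: measurable_funepos.
- by move=> x _; rewrite sube_ge0 ?fnc ?orbT.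
- apply: emeasurable_funB => //; exact: measurable_funeneg.
Qed.

Lemma integral_ge_lbounded (d : measure_display) (T : measurableType d)
    (R : realType) (P : probability T R) (c : R) (f : T -> \bar R) :
  0 <= c -> measurable_fun [set: T] f -> (forall x, (- c)%:E <= f x)%E ->
  ((- c)%:E <= \int[P]_x f x)%E.
Proof.
move=> c0 mf fc; have : (0 <= \int[P]_x (f x + c%:E))%E.
  by apply: integral_ge0 => x _; rewrite -leeBlDr// sub0e -EFinN.
by rewrite integralD_cst_lbounded// -leeBlDr// sub0e -EFinN.
Qed.

(** * Truncated infima over shrinking balls *)

Section lower_envelope.
Context (R : realType) (X : normedModType R).
Implicit Types (F : X -> \bar R) (x : X) (k : nat).
Local Open Scope ereal_scope.

(* The infimum over an open ball is upper semicontinuous in the center, which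
   is what makes its composition with a strongly measurable map measurable. *)
Definition lower_envelope F k x :=
  mine k%:R%:E (ereal_inf (F @` ball x k.+1%:R^-1)).

Lemma lower_envelope_ge0 F k x : (forall y, 0 <= F y) ->
  0 <= lower_envelope F k x.
Proof.
move=> F0; rewrite /lower_envelope le_min lee_fin ler0n/=.
by apply: le_ereal_inf_tmp => _ [y _ <-].
Qed.

Lemma lower_envelope_le_nat F k x : lower_envelope F k x <= k%:R%:E.
Proof. by rewrite /lower_envelope ge_min lexx. Qed.

Lemma lower_envelope_le F k x y : ball x k.+1%:R^-1 y ->
  lower_envelope F k x <= F y.
Proof.
move=> xy; rewrite /lower_envelope ge_min; apply/orP; right.
by apply: ge_ereal_inf; exists (F y) => //; exists y.
Qed.

Lemma nondecreasing_lower_envelope F x :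
  nondecreasing_seq (fun k => lower_envelope F k x).
Proof.
move=> m n mn; rewrite /lower_envelope le_min; apply/andP; split.
  by rewrite ge_min lee_fin ler_nat mn.
rewrite ge_min; apply/orP; right; apply: ereal_inf_le_tmp.
by apply/image_subset/le_ball; rewrite lef_pV2 ?posrE// ler_nat ltnS.
Qed.

(** Each envelope is at most [F x] because [x] is in its own ball. Conversely, a real [c < F x] is a
    lower bound of [F] on a small ball, and the cap eventually exceeds [c]. *)
Lemma lim_lower_envelope F x : lower_semicontinuous F ->
  limn (fun k => lower_envelope F k x) = F x.
Proof.
move=> lF; have nd := @nondecreasing_lower_envelope F x.
have /cvg_lim -> // := ereal_nondecreasing_cvgn nd.
apply/eqP; rewrite eq_le; apply/andP; split.
  apply: ge_ereal_sup => _ [k _ <-]; apply: lower_envelope_le.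
  by apply: ballxx; rewrite invr_gt0.
rewrite leNgt; apply/negP => /lte_dense_EFin[c /andP[sc cF]].
move: sc; rewrite ltNge => /negP; apply.
have [V /nbhs_ballP[e /= e0 eV] cV] := lF _ _ cF.
have [k] := ltr_add_invr e0; rewrite add0r => ke.
(* The first argument makes the ball small enough, the second lifts the cap above [c]. *)
pose n := maxn k (Num.trunc `|c|).+1.
apply: le_ereal_sup_tmp; exists (lower_envelope F n x); first by exists n.
rewrite /lower_envelope le_min; apply/andP; split.
  rewrite lee_fin (le_trans (ler_norm c))// (le_trans (ltW (truncnS_gt _)))//.
  by rewrite ler_nat leq_maxr.
apply: le_ereal_inf_tmp => _ [y xy <-]; apply/ltW/cV/eV.
apply: (le_ball _ xy); rewrite (le_trans _ (ltW ke))//.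
by rewrite lef_pV2 ?posrE// ler_nat ltnS leq_maxl.
Qed.

(** For [a] above the cap this is the whole space. Otherwise only the infimum can be below [a], and
    by symmetry of balls the set is a union of open balls centered in the sublevel set of [F]. *)
Lemma open_lower_envelope_lt F k (a : R) :
  open [set x | lower_envelope F k x < a%:E].
Proof.
have [ka|ak] := ltP k%:R%:E a%:E.
  rewrite (_ : [set x | _] = setT); first exact: openT.
  apply/seteqP; split => // x _ /=.
  exact: le_lt_trans (lower_envelope_le_nat _ _ _) ka.
rewrite (_ : [set x | _] =
    \bigcup_(y in [set y | F y < a%:E]) ball y k.+1%:R^-1).
  by apply: bigcup_open => y _; apply: ball_open; rewrite invr_gt0.
apply/seteqP; split => x /=.
  rewrite /lower_envelope gt_min ltNge ak/= => /ereal_inf_ltP[_ [y xy <-]] ya.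
  by exists y => //; exact: ball_sym.
by case=> y /= ya /ball_sym/lower_envelope_le xy; exact: le_lt_trans ya.
Qed.

Lemma lower_envelope_comp_measurable (d : measure_display)
    (T : measurableType d) F k (f : T -> X) : strongly_measurable f ->
  measurable_fun [set: T] (lower_envelope F k \o f).
Proof.
move=> sf; apply: (measurability _ (ErealGenCInfty.measurableE R)).
move=> /= _ [_ [a ->]] <-; apply: measurableI => //; rewrite preimage_itvcy.
rewrite (_ : [set x | _] =
    ~` (f @^-1` [set x | lower_envelope F k x < a%:E])); last first.
  by apply/seteqP; split => x /=; rewrite leNgt => /negP.
apply: measurableC; apply: strongly_measurable_open => //.
exact: open_lower_envelope_lt.
Qed.

End lower_envelope.

(** * Lower semicontinuity of the integral under convergence in probability *)

Section integral_lower_semicontinuous.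
Context (d : measure_display) (T : measurableType d) (R : realType)
  (P : probability T R) (X : normedModType R) (I : Type) (G : set_system I).
Implicit Types (F : X -> \bar R) (y : T -> X).
Local Open Scope ereal_scope.

Definition cvg_in_measure (y_ : I -> T -> X) y :=
  forall a eps : R, (0 < a)%R -> (0 < eps)%R ->
  \forall i \near G, P [set x | a <= `|y_ i x - y x|]%R <= eps%:E.

Hypothesis FG : Filter G.

(** Monotone convergence fixes one [k] whose envelope along [y] already has integral above [b].
    Replacing this envelope by [F (y_ i x)] then costs at most [k] times the probability of a
    deviation of [1/(k+1)] or more. *)
Lemma ge0_integral_lsc F (y_ : I -> T -> X) y : lower_semicontinuous F ->
  (forall p, 0 <= F p) -> (forall i, strongly_measurable (y_ i)) ->
  strongly_measurable y -> cvg_in_measure y_ y ->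
  forall b : R, b%:E < \int[P]_x F (y x) ->
    \forall i \near G, b%:E < \int[P]_x F (y_ i x).
Proof.
move=> lF F0 sy_ sy yy b by_.
have mE k : measurable_fun [set: T] (fun x => lower_envelope F k (y x)).
  exact: lower_envelope_comp_measurable.
have E0 k x : 0 <= lower_envelope F k (y x) by exact: lower_envelope_ge0.
have nd x : nondecreasing_seq (fun k => lower_envelope F k (y x)).
  exact: nondecreasing_lower_envelope.
have [k bk] : exists k, b%:E < \int[P]_x lower_envelope F k (y x).
  apply: contrapT => /forallNP bk; move: by_; rewrite ltNge => /negP; apply.
  under eq_integral do rewrite -lim_lower_envelope//.
  rewrite monotone_convergence//.
  apply: lime_le; last by apply: nearW => k; rewrite leNgt; exact/negP.
  apply: ereal_nondecreasing_is_cvgn => m n mn.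
  by apply: ge0_le_integral => // x _; exact: nd.
set J := \int[P]_x _ in bk.
have Jk : J <= k%:R%:E.
  apply: (@le_trans _ _ (\int[P]_x (cst k%:R%:E x))).
    by apply: ge0_le_integral => // x _; exact: lower_envelope_le_nat.
  rewrite integral_cst//= [X in _ * X](@probability_setT _ _ _ P).
  by rewrite mule1.
(* The cap makes [J] finite, so the gap [J - b] is a positive real. *)
have JE : J = (fine J)%:E.
  by rewrite fineK// ge0_fin_numE ?integral_ge0// (le_lt_trans Jk) ?ltry.
rewrite JE lte_fin in bk.
pose r : R := (k.+1%:R^-1)%R.
(* Dividing by [k+1] makes [k * eps] strictly smaller than [J - b], also when [k = 0]. *)
pose eps := ((fine J - b) / k.+1%:R)%R.
have r0 : (0 < r)%R by rewrite invr_gt0.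
have eps0 : (0 < eps)%R by rewrite divr_gt0// subr_gt0.
move: (yy r eps r0 eps0); apply: filterS => i Pi.
rewrite ltNge; apply/negP => ib.
pose A := [set x | r <= `|y_ i x - y x|]%R.
have mA : measurable A.
  rewrite (_ : A = setT `&` (fun x => `|y_ i x - y x|%R) @^-1` `[r, +oo[).
    apply: measurable_norm_strongly_measurable => //.
    have := strongly_measurable_lin (-1) sy (sy_ i).
    by congr strongly_measurable; apply/funext => x /=; rewrite scaleN1r addrC.
  by rewrite setTI; apply/seteqP; split => x /=; rewrite in_itv/= andbT.
have mFi : measurable_fun [set: T] (fun x => F (y_ i x)).
  exact: lower_semicontinuous_comp_measurable.
have m1 : measurable_fun [set: T] (fun x => (k%:R * \1_A x)%R%:E : \bar R).
  by apply/measurable_EFinP; apply: measurable_funM.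
have : J <= \int[P]_x (F (y_ i x) + (k%:R * \1_A x)%R%:E).
  apply: ge0_le_integral => //; first exact: emeasurable_funD.
  (* On [A] the added [k] dominates the capped envelope; off [A] the point [y_ i x] lies in the ball
     over which the infimum is taken. *)
  move=> x _; have [xA|xA] := boolP (x \in A).
    rewrite indicE xA mulr1 (le_trans (lower_envelope_le_nat _ _ _))//.
    by rewrite leeDr.
  rewrite indicE (negbTE xA) mulr0 adde0; apply: lower_envelope_le.
  rewrite -ball_normE/= distrC ltNge.
  by apply: contra xA => xr; rewrite inE.
rewrite ge0_integralD//.
under [X in _ + X]eq_integral do rewrite EFinM.
rewrite ge0_integralZl//; last exact/measurable_EFinP.
rewrite integral_indic// setIT => JA.
have : J <= b%:E + k%:R%:E * eps%:E.
  by apply: (le_trans JA); apply: leeD => //; apply: lee_wpmul2l.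
rewrite JE -EFinM -EFinD lee_fin leNgt => /negP; apply.
rewrite /eps -ltrBrDl mulrCA gtr_pMr ?subr_gt0//.
by rewrite ltr_pdivrMr// mul1r ltr_nat.
Qed.

(** Adding [c] reduces to the nonnegative case: both integrals shift by exactly [c], since [P] has
    mass 1. *)
Lemma lbounded_integral_lsc F (y_ : I -> T -> X) y (c : R) :
  lower_semicontinuous F -> (0 <= c)%R -> (forall p, (- c)%:E <= F p) ->
  (forall i, strongly_measurable (y_ i)) ->
  strongly_measurable y -> cvg_in_measure y_ y ->
  forall b : R, b%:E < \int[P]_x F (y x) ->
    \forall i \near G, b%:E < \int[P]_x F (y_ i x).
Proof.
move=> lF c0 Fc sy_ sy yy b.
pose Fc_ p := F p + c%:E.
have FcE (u : T -> X) : strongly_measurable u ->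
    \int[P]_x Fc_ (u x) = \int[P]_x F (u x) + c%:E.
  move=> su; apply: integralD_cst_lbounded => //.
  exact: lower_semicontinuous_comp_measurable.
have lFc : lower_semicontinuous Fc_.
  move=> p a; rewrite /Fc_ -lteBlDr// -EFinB => /lF[V pV aV].
  by exists V => // u /aV; rewrite EFinB lteBlDr.
have Fc0 p : 0 <= Fc_ p by rewrite /Fc_ -leeBlDr// sub0e -EFinN.
have := ge0_integral_lsc lFc Fc0 sy_ sy yy (b := (b + c)%R).
rewrite EFinD FcE// lteD2rE// => h /h; apply: filterS => i.
by rewrite FcE// lteD2rE.
Qed.

End integral_lower_semicontinuous.

(** * From norm convergence to convergence in probability *)

Lemma Lnorm_markov (d : measure_display) (T : measurableType d) (R : realType)
    (P : probability T R) (q : \bar R) (w : T -> R) (a eps : R) :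
  (1 <= q)%E -> measurable_fun [set: T] w -> 0 < a -> 0 < eps <= 1 ->
  ('N[P]_q[EFin \o w] < (a * eps)%:E)%E ->
  (P [set x | a <= `|w x|]%R <= eps%:E)%E.
Proof.
move=> q1 mw a0 /andP[eps0 eps1] wa.
have wA : [set x | a <= `|w x|] =
    [set: T] `&` [set x | (a%:E <= `|(EFin \o w) x|)%E].
  by rewrite setTI.
case: q q1 wa => [r| |]//; rewrite ?lee_fin.
(* Markov's inequality for [r]-th powers bounds the probability by [eps] to the power [r], which is
   at most [eps] because [eps <= 1 <= r]. *)
- move=> r1 wa; have r0 : 0 < r by rewrite (lt_le_trans ltr01).
  have nd : {in `[0%E, +oo[%classic &, {homo (fun x : \bar R => x `^ r)%E :
      x y / (x <= y)%E}}.
    move=> x y; rewrite !inE/= !in_itv/= => /andP[x0 _] /andP[y0 _] xy.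
    by apply: gt0_ler_poweR => //; rewrite ?in_itv/= ?x0 ?y0 ?leey// ltW.
  have := le_integral_comp_abse P measurableT (measurable_poweR r)
    (fun x _ => poweR_ge0 x r) nd (f := poweR ^~ r) (g := EFin \o w) _ a0.
  rewrite -wA => /(_ (proj2 (measurable_EFinP _ _) mw)).
  rewrite -poweR_Lnorm ?gt_eqF// => aP.
  have : ('N[P]_r%:E[EFin \o w] `^ r <= (a * eps)%:E `^ r)%E.
    apply: gt0_ler_poweR; rewrite ?in_itv/= ?leey ?andbT ?Lnorm_ge0//.
    - exact: ltW.
    - by rewrite lee_fin mulr_ge0// ltW.
    - exact: ltW.
  move=> /(le_trans aP); rewrite !poweR_EFin (powRM _ (ltW a0) (ltW eps0)).
  rewrite EFinM lee_pmul2l ?lte_fin ?powR_gt0//.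
  move/le_trans; apply; rewrite lee_fin.
  rewrite -[leRHS](powRr1 (ltW eps0)).
  by apply: ger_powR => //; rewrite eps0.
(* The norm is an essential supremum only on a space of positive mass, which holds for [P]. Then
   [|w| < a] almost everywhere and the event is null. *)
- rewrite unlock /Lnorm; case: ifPn; last first.
    by rewrite [X in (_ < X)%E](@probability_setT _ _ _ P) lte01.
  move=> _ _ wa.
  have : (\forall x \ae P, `|(EFin \o w) x| < a%:E)%E.
    have := ess_sup_ge P (abse \o (EFin \o w)).
    apply: filterS => x /le_lt_trans; apply.
    by rewrite (lt_le_trans wa)// lee_fin ler_piMr// ltW.
  move=> [A [mA A0 wAs]].
  apply: (@le_trans _ _ 0%E); last by rewrite lee_fin ltW.
  rewrite -A0 le_measure ?inE//.
    rewrite wA; apply: emeasurable_fun_c_infty => //.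
    by apply: measurableT_comp => //; exact/measurable_EFinP.
  by move=> x /= ax; apply: wAs => /=; rewrite lte_fin ltNge ax.
Qed.

Section cvg_in_measure_bochner.
Context (d : measure_display) (T : measurableType d) (R : realType)
  (P : probability T R) (V : normedModType R) (q : \bar R) (q1 : (1 <= q)%E).

Lemma cvg_in_measure_bochner (I : Type) (G : set_system I)
    (f_ : I -> bochner_map P V q1) (f : bochner_map P V q1) : Filter G ->
  bochner_norm (f_ i - f) @[i --> G] --> 0 ->
  cvg_in_measure P G (fun i => f_ i : T -> V) f.
Proof.
move=> FG ff a eps a0 eps0.
(* The Markov bound requires a tolerance of at most 1. *)
have e0 : 0 < Num.min eps 1 by rewrite lt_min eps0 ltr01.
have /cvgr0Pnorm_lt/(_ _ (mulr_gt0 a0 e0)) := ff.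
apply: filterS => i fi; apply: (@le_trans _ _ (Num.min eps 1)%:E).
  under eq_set do rewrite -[`|_ - _|]normr_id.
  apply: (Lnorm_markov q1) => //; last 2 first.
  - by rewrite e0 ge_min lexx orbT.
  - have := bochner_normE (f_ i - f) => /= <-.
    by rewrite lte_fin (le_lt_trans (ler_norm _)).
  exact: measurable_norm (bochner_funP (f_ i - f)).
by rewrite lee_fin ge_min lexx.
Qed.

End cvg_in_measure_bochner.

(** The product norm is a maximum and the second component does not depend on [x]: once [w_ i] is
    within [a] of [w], it no longer contributes to the event. *)
Lemma cvg_in_measure_pair (d : measure_display) (T : measurableType d)
    (R : realType) (P : probability T R) (X W : normedModType R) (I : Type)
    (G : set_system I) (f_ : I -> T -> X) (f : T -> X) (w_ : I -> W) (w : W) :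
  Filter G -> cvg_in_measure P G f_ f -> w_ i @[i --> G] --> w ->
  cvg_in_measure P G (fun i x => (f_ i x, w_ i)) (fun x => (f x, w)).
Proof.
move=> FG ff /cvgrPdist_lt ww a eps a0 eps0.
apply: filterS2 (ff a eps a0 eps0) (ww a a0) => i Pi wi.
rewrite (_ : [set x | _] = [set x | a <= `|f_ i x - f x|])//.
apply/seteqP; split => x /=; rewrite prod_normE/= le_max; last by move=> ->.
by move=> /orP[//|]; rewrite distrC leNgt wi.
Qed.

Lemma strongly_measurable_pair (d : measure_display) (T : measurableType d)
    (R : realType) (X W : normedModType R) (f : T -> X) (w : W) :
  strongly_measurable f -> strongly_measurable (fun x => (f x, w)).
Proof.
move=> [f_ sf cf]; exists (fun n x => (f_ n x, w)) => [n|x].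
  have [ff mf] := sf n; split.
    apply: (sub_finite_set _ (finite_image (fun v => (v, w)) ff)) => _ [x _ <-].
    by exists (f_ n x) => //; exists x.
  move=> [v w']; have [<-|ww'] := pselect (w = w').
    rewrite (_ : _ @^-1` _ = f_ n @^-1` [set v]); first exact: mf.
    by apply/seteqP; split => x /= [->].
  rewrite (_ : _ @^-1` _ = set0); first exact: measurable0.
  by apply/seteqP; split => x //= [_ /ww'].
by apply: cvg_pair => //; exact: cvg_cst.
Qed.

(** Eventually [theta >= 1], so the power of [n] is bounded by its product with [theta]. *)
Lemma cvg0_of_powR_cvg0 (R : realType) (I : Type) (G : set_system I)
    (theta n : I -> R) (r : R) : Filter G -> 0 < r -> (forall i, 0 <= n i) ->
  theta i @[i --> G] --> +oo -> theta i * n i `^ r @[i --> G] --> 0 ->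
  n i @[i --> G] --> 0.
Proof.
move=> FG r0 n0 thetay /cvgr0Pnorm_lt thetan.
apply/cvgr0Pnorm_lt => e e0.
have er0 : 0 < e `^ r by rewrite powR_gt0.
have /cvgryPge/(_ 1) theta1 := thetay.
apply: filterS2 (thetan _ er0) theta1 => i tn t1.
rewrite ger0_norm// ltNge; apply/negP => en.
move: tn; rewrite ltNge => /negP; apply.
rewrite ger0_norm ?mulr_ge0 ?powR_ge0// ?(le_trans ler01)//.
apply: (@le_trans _ _ (n i `^ r)).
  by rewrite ge0_ler_powR ?nnegrE// ltW.
by rewrite ler_peMl ?powR_ge0.
Qed.

(** Lets the semicontinuity of [f0] and that of the integral be applied separately. Two finite
    summands share the slack equally; an infinite summand absorbs whatever the other one lacks. *)
Lemma lte_add_split (R : realType) (x y : \bar R) (c : R) :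
  (-oo < x)%E -> (-oo < y)%E -> (c%:E < x + y)%E ->
  exists a b : R, [/\ (a%:E < x)%E, (b%:E < y)%E & c <= a + b].
Proof.
case: x y => [x| |] [y| |]// _ _.
- rewrite -EFinD lte_fin => cxy.
  exists (x - (x + y - c) / 2), (y - (x + y - c) / 2).
  by rewrite !lte_fin; split; lra.
- move=> _; exists (x - 1), (c - x + 1).
  by rewrite lte_fin ltry; split => //; lra.
- move=> _; exists (c - y + 1), (y - 1).
  by rewrite lte_fin ltry; split => //; lra.
- by move=> _; exists c, 0; rewrite !ltry addr0.
Qed.

(** * Almost everywhere calculus for Bochner classes *)

Section Bochner_theory.
Context (d : measure_display) (T : measurableType d) (R : realType)
  (mu : {measure set T -> \bar R}) (V : normedModType R)
  (q : \bar R) (q1 : (1 <= q)%E).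
Implicit Types t u : Bochner mu V q1.

Lemma Bochner_strongly_measurable t : strongly_measurable t.
Proof. by have := bochner_funP (repr t); rewrite inE => -[]. Qed.

Lemma Bochner_subE t u : {ae mu, forall x, Bochner_fun (t - u) x = t x - u x}.
Proof.
apply: filterS2 (Bochner_funE (repr t + repr (- u))) (Bochner_funE (- repr u)).
by move=> x tu ux; exact: etrans tu (congr1 (+%R (t x)) ux).
Qed.

Lemma Bochner_eq0 t : {ae mu, forall x, t x = 0} -> t = 0.
Proof.
elim/Bochner_classW: t => t t0; apply/Bochner_classP.
by apply: filterS2 t0 (Bochner_funE t) => x -> <-.
Qed.

End Bochner_theory.

(** * The penalty term in the finite and infinite exponent cases *)

Section penalty.
Context (R : realType) (d : measure_display) (Xi : measurableBanachType d R)
  (P : probability Xi R) (q : \bar R) (q1 : (1 <= q)%E).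
Implicit Type t : Bochner P Xi q1.

Lemma penalty_fin t (r : R) : q = r%:E -> penalty t = r^-1 * `|t| `^ r.
(* The type of [t] depends on [q]; generalizing the norm to a real number frees [q] for
   rewriting. *)
Proof. by rewrite /penalty; move: `|t| => n ->. Qed.

Lemma penalty_infty t : q = +oo%E -> penalty t = `|t|.
Proof. by rewrite /penalty; move: `|t| => n ->. Qed.

Lemma exponent_cases : (exists2 r : R, q = r%:E & 1 <= r) \/ q = +oo%E.
Proof. by move: q1; case: (q) => [r| |]//; [left; exists r|right]. Qed.

Lemma penalty_ge0 t : 0 <= penalty t.
Proof.
have [[r qr r1]|qy] := exponent_cases; last by rewrite penalty_infty.
by rewrite (penalty_fin _ qr) mulr_ge0 ?powR_ge0// invr_ge0 (le_trans ler01).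
Qed.

(** Makes [theta] times the penalty blow up along families that stay away from 0. *)
Lemma penalty_lbound (a : R) : 0 < a ->
  exists2 b : R, 0 < b & forall t, a <= `|t| -> b <= penalty t.
Proof.
move=> a0; have [[r qr r1]|qy] := exponent_cases; last first.
  by exists a => // t; rewrite penalty_infty.
have r0 : 0 < r by rewrite (lt_le_trans ltr01).
exists (r^-1 * a `^ r); first by rewrite mulr_gt0 ?invr_gt0 ?powR_gt0.
move=> t at_; rewrite (penalty_fin _ qr) ler_pM2l ?invr_gt0//.
by rewrite ge0_ler_powR ?nnegrE// ltW.
Qed.

End penalty.

(** * Recovery families and the lower bound *)

Section Gamma_cvg.
Context (R : realType) (d : measure_display)
  (U Z : completeNormedModType R) (Xi : measurableBanachType d R)
  (P : probability Xi R) (f0 : Z -> \bar R) (s : Xi -> Z -> U)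
  (g : U -> \bar R) (hFG : assumption_FG f0 g) (hS : assumption_S' s)
  (q : \bar R) (q1 : (1 <= q)%E)
  (theta : R -> R) (theta_gt0 : forall e, 0 < e -> 0 < theta e)
  (theta_cvg : theta e @[e --> 0^'+] --> +oo)
  (idT : Bochner P Xi q1) (idTE : {ae P, forall xi, idT xi = xi})
  (eta : R -> Bochner P Xi q1)
  (eta_fin : forall r : R, q = r%:E ->
    theta e * `|eta e - idT| `^ r @[e --> 0^'+] --> 0)
  (eta_infty : q = +oo%E ->
    theta e * `|eta e - idT| @[e --> 0^'+] --> 0).

Let F (p : Xi * Z) : \bar R := g (s p.1 p.2).

Lemma lower_semicontinuous_f0 : lower_semicontinuous f0.
Proof.
have [_ [lf0 _] _] := hFG; apply: lower_semicontinuous_family => z_ z zz.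
exact/lf0/strongly_weakly_cvg.
Qed.

(** Norm convergence of a pair gives norm convergence in [Xi] and weak convergence in [Z]; [s] turns
    these into weak convergence in [U], where [g] is lower semicontinuous. *)
Lemma lower_semicontinuous_gs : lower_semicontinuous F.
Proof.
have [_ [_ lg] _] := hFG; have [_ cs] := hS.
apply: lower_semicontinuous_family => p_ p pp; apply: lg; apply: cs.
  exact: cvg_comp pp (@cvg_fst _ _ _ _ _).
by apply: strongly_weakly_cvg; exact: cvg_comp pp (@cvg_snd _ _ _ _ _).
Qed.

Lemma eta_cvg : eta e @[e --> 0^'+] --> idT.
Proof.
suff : `|eta e - idT| @[e --> 0^'+] --> 0.
  move=> /cvgr0Pnorm_lt h; apply/cvgrPdist_lt => a a0.
  by apply: filterS (h a a0) => e; rewrite normr_id distrC.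
have [[r qr r1]|qy] := exponent_cases q1.
  apply: (cvg0_of_powR_cvg0 _ _ _ theta_cvg (eta_fin qr)) => //.
  by rewrite (lt_le_trans ltr01).
(* For the infinite exponent the norm enters to the first power. *)
apply: (cvg0_of_powR_cvg0 (r := 1) _ _ _ theta_cvg) => //.
by under eq_fun do rewrite powRr1//; exact: eta_infty.
Qed.

Lemma theta_penalty_cvg : theta e * penalty (idT - eta e) @[e --> 0^'+] --> 0.
Proof.
have [[r qr r1]|qy] := exponent_cases q1; last first.
  under eq_fun do rewrite penalty_infty// distrC.
  exact: eta_infty.
under eq_fun do rewrite (penalty_fin _ qr) distrC mulrCA.
have := cvgM (@cvg_cst _ r^-1 _ (0:R)^'+ _) (eta_fin qr).
by rewrite mulr0 => h; exact: h.
Qed.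

(** Serves [Phi] at [t = 0] and [Phi_] along the recovery family. The right-hand side uses [idT]
    because its representative is strongly measurable. *)
Lemma integral_gs_id (z : Z) (u : Xi -> Xi) :
  {ae P, forall xi, u xi = xi} ->
  (\int[P]_xi g (s (u xi) z) = \int[P]_xi F (idT xi, z))%E.
Proof.
move=> uE; apply: eq_integral_ae.
by apply: filterS2 uE idTE => xi; rewrite /F/= => -> ->.
Qed.

Lemma Phi_recovery (z : Z) (t : Bochner P Xi q1) :
  exists2 x_ : R -> Z * Bochner P Xi q1, x_ e @[e --> 0^'+] --> (z, t) &
    (limf_esup (fun e => Phi_ f0 s g theta eta e (x_ e)) 0^'+ <=
     Phi f0 s g (z, t))%E.
Proof.
rewrite /Phi; case: asboolP => t0; last first.
  by exists (fun=> (z, t)); [exact: cvg_cst|rewrite leey].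
have tE := Bochner_eq0 t0.
exists (fun e => (z, idT - eta e)).
  have : idT - eta e @[e --> 0^'+] --> t.
    have := cvgB (@cvg_cst _ idT _ (0:R)^'+ _) eta_cvg.
    by rewrite subrr tE => h; exact: h.
  by move=> h; exact: cvg_pair (@cvg_cst _ z _ (0:R)^'+ _) h.
rewrite (@integral_gs_id z (fun xi => xi + t xi)); last first.
  by apply: filterS t0 => xi ->; rewrite addr0.
set J := (f0 z + _)%E; apply: limf_esup_le => c Jc.
have JE e : Phi_ f0 s g theta eta e (z, idT - eta e) =
    (J + (theta e * penalty (idT - eta e))%:E)%E.
  rewrite /Phi_ (@integral_gs_id z
    (fun xi => eta e xi + Bochner_fun (idT - eta e) xi))//.
  apply: filterS2 (Bochner_subE idT (eta e)) idTE => xi -> ->.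
  by rewrite addrC subrK.
(* [J] need not be real, so the penalty is absorbed by the gap between [c] and a real [c'] strictly
   above [J]. *)
have [c' /andP[Jc' c'c]] := lte_dense_EFin Jc; rewrite lte_fin in c'c.
have /cvgr0Pnorm_lt/(_ (c - c')) := theta_penalty_cvg.
rewrite subr_gt0 => /(_ c'c); apply: filterS => e te.
rewrite JE (_ : c = c' + (c - c')); last by rewrite addrC subrK.
rewrite EFinD; apply: leeD; first exact: ltW.
by rewrite lee_fin (le_trans (ler_norm _))// ltW.
Qed.

Let gs_lbounded : exists2 c : R, 0 <= c & forall p, ((- c)%:E <= F p)%E.
Proof.
have [_ _ [gamma hg]] := hFG; exists `|gamma| => // p.
by rewrite (le_trans _ (hg _))// lee_fin lerNl (le_trans (ler_norm _))// normrN.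
Qed.

Let strongly_measurable_etaD e (t : Bochner P Xi q1) (z : Z) :
  strongly_measurable (fun xi => (eta e xi + t xi, z)).
Proof.
apply: strongly_measurable_pair.
have := bochner_funP (repr (eta e) + repr t); rewrite inE => -[+ _].
exact.
Qed.

Lemma integral_gs_lsc (z_ : R -> Z) (z : Z) (t_ : R -> Bochner P Xi q1)
    (b : R) :
  z_ e @[e --> 0^'+] --> z -> t_ e @[e --> 0^'+] --> 0 ->
  (b%:E < \int[P]_xi F (idT xi, z))%E ->
  \forall e \near 0^'+,
    (b%:E < \int[P]_xi g (s (eta e xi + t_ e xi)%R (z_ e)))%E.
Proof.
move=> zz tt; have [c c0 Fc] := gs_lbounded.
pose y_ (e : R) xi := (eta e xi + t_ e xi, z_ e).
apply: (lbounded_integral_lsc (y_ := y_) _ lower_semicontinuous_gs c0 Fc).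
- by move=> e; exact: strongly_measurable_etaD.
- exact/strongly_measurable_pair/Bochner_strongly_measurable.
- apply: cvg_in_measure_pair => //.
  apply: (@cvg_in_measure_bochner _ _ _ P Xi q q1 _ _
    (fun e => repr (eta e) + repr (t_ e)) (repr idT)).
  have : eta e + t_ e - idT @[e --> 0^'+] --> 0.
    have := cvgB (cvgD eta_cvg tt) (@cvg_cst _ idT _ (0:R)^'+ _).
    by rewrite addr0 subrr => h; exact: h.
  move=> /cvg_norm; rewrite normr0.
  (* The integrand adds chosen representatives pointwise, whereas the norm is that of the class of
     the sum; the two agree on norms. *)
  suff E e : `|eta e + t_ e - idT| =
      bochner_norm (repr (eta e) + repr (t_ e) - repr idT).
    by under eq_fun do rewrite E.
  rewrite -Bochner_normE; congr Bochner_norm.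
  exact: (Bochner_addE (repr (eta e) + repr (t_ e)) (- repr idT)).
Qed.

Lemma Phi_liminf (x_ : R -> Z * Bochner P Xi q1) (x : Z * Bochner P Xi q1) :
  x_ e @[e --> 0^'+] --> x ->
  (Phi f0 s g x <= limf_einf (fun e => Phi_ f0 s g theta eta e (x_ e)) 0^'+)%E.
Proof.
case: x => z t xx.
pose z_ e := (x_ e).1; pose t_ e := (x_ e).2.
have zz : z_ e @[e --> 0^'+] --> z by exact: cvg_comp xx (@cvg_fst _ _ _ _ _).
have tt : t_ e @[e --> 0^'+] --> t by exact: cvg_comp xx (@cvg_snd _ _ _ _ _).
have PhiE e : Phi_ f0 s g theta eta e (x_ e) =
    (f0 (z_ e) + \int[P]_xi g (s (eta e xi + t_ e xi)%R (z_ e)) +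
      (theta e * penalty (t_ e))%:E)%E.
  by rewrite /z_ /t_; case: (x_ e).
have [[f0N _] _ _] := hFG.
have [c0 c0_ge0 Fc0] := gs_lbounded.
have f0_near (m : R) : (m%:E < f0 z)%E ->
    \forall e \near 0^'+, (m%:E < f0 (z_ e))%E.
  move=> /lower_semicontinuous_f0[V zV Vm].
  have : \forall e \near 0^'+, V (z_ e) by exact: zz.
  by apply: filterS => e; exact: Vm.
have [m /andP[_ mz]] := lte_dense_EFin (f0N z).
apply: le_limf_einf => c; rewrite /Phi; case: asboolP => t0.
  rewrite (@integral_gs_id z (fun xi => xi + t xi)); last first.
    by apply: filterS t0 => xi ->; rewrite addr0.
  (* The remaining side condition, that the integral is not [-oo], follows from the lower bound
     [- c0]. *)
  move=> /lte_add_split[//||a [b [az bJ cab]]].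
    have mF := lower_semicontinuous_comp_measurable lower_semicontinuous_gs
      (strongly_measurable_pair z (Bochner_strongly_measurable idT)).
    apply: lt_le_trans (ltNyr _) _.
    exact: (integral_ge_lbounded P c0_ge0 mF (fun=> Fc0 _)).
  move: tt; rewrite (Bochner_eq0 t0) => /(integral_gs_lsc zz)/(_ bJ) bnear.
  apply: filterS3 (f0_near _ az) bnear (nbhs_right_gt 0) => e ae be e0.
  rewrite PhiE (@le_trans _ _ (a%:E + b%:E + 0%:E)%E)//.
    by rewrite -!EFinD lee_fin addr0.
  apply: leeD; first by apply: leeD; exact: ltW.
  by rewrite lee_fin mulr_ge0 ?penalty_ge0// ltW// theta_gt0.
(* A [t] that is not almost surely 0 has positive norm, so the norms of [t_ e] eventually exceed
   half of it and the penalties exceed a fixed [b > 0]. *)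
move=> _; have t_gt0 : 0 < `|t|.
  rewrite normr_gt0; apply/eqP => tE; apply: t0; rewrite tE.
  exact: (Bochner_funE 0).
have [b b0 bP] := penalty_lbound P q1 (divr_gt0 t_gt0 (ltr0Sn R 1)).
have t_near : \forall e \near 0^'+, `|t| / 2 <= `|t_ e|.
  have /cvg_norm/cvgr_ge := tt; apply.
  by rewrite ltr_pdivrMr// ltr_pMr// ltr1n.
(* With [m] bounding [f0] and [- c0] the integral, this threshold makes the total at least [c]. The
   maximum with 0 ensures [theta e >= 0], needed to multiply the bound on the penalty. *)
have /cvgryPge/(_ (Num.max 0 ((c - m + c0) / b))) theta_near := theta_cvg.
apply: filterS3 (f0_near _ mz) t_near theta_near => e me te.
rewrite ge_max => /andP[th0 thc]; rewrite PhiE.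
apply: (@le_trans _ _ (m%:E + (- c0)%:E + (c - m + c0)%:E)%E).
  by rewrite -!EFinD lee_fin; lra.
apply: leeD; first apply: leeD.
- exact: ltW.
- apply: (integral_ge_lbounded P c0_ge0) => [|xi]; last exact: (Fc0 (_, _)).
  exact: (lower_semicontinuous_comp_measurable lower_semicontinuous_gs
    (strongly_measurable_etaD e (t_ e) (z_ e))).
rewrite lee_fin (@le_trans _ _ (theta e * b))//; first by rewrite -ler_pdivrMr.
by apply: ler_wpM2l => //; exact: bP.
Qed.

End Gamma_cvg.

Theorem theorem3p6 (R : realType) (d : measure_display)
    (U Z : completeNormedModType R) (Xi : measurableBanachType d R)
    (sepXi : separable Xi) (P : probability Xi R)
    (f0 : Z -> \bar R) (s : Xi -> Z -> U) (g : U -> \bar R)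
    (hFG : assumption_FG f0 g) (hS : assumption_S' s)
    (q : \bar R) (q1 : (1 <= q)%E)
    (theta : R -> R) (theta_gt0 : forall e, 0 < e -> 0 < theta e)
    (theta_cvg : theta e @[e --> 0^'+] --> +oo)
    (idT : Bochner P Xi q1) (idTE : {ae P, forall xi, idT xi = xi})
    (eta : R -> Bochner P Xi q1)
    (eta_fin : forall r : R, q = r%:E ->
      theta e * `|eta e - idT| `^ r @[e --> 0^'+] --> 0)
    (eta_infty : q = +oo%E ->
      theta e * `|eta e - idT| @[e --> 0^'+] --> 0) :
  Gamma_s_cvg (Phi_ f0 s g theta eta)
    (Phi f0 s g : Z * Bochner P Xi q1 -> \bar R).
Proof.
split => [[z t]|x_ x xx].
- exact: (Phi_recovery f0 s g theta_cvg idTE eta_fin eta_infty z t).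
- exact: (Phi_liminf hFG hS theta_gt0 theta_cvg idTE eta_fin eta_infty xx).
Qed.
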